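(* The set $X=\overline{\{T_\omega(\mathfrak{J}) : \omega\in\mathbb{F}_2^+\}}$, the orbit closure of the Jacaranda tree $\mathfrak{J}$, is strongly aperiodic; that is, there are no $\mathfrak{A}\in X$ and $\omega\in\mathbb{F}_2^+$ with $|\omega|\ge 1$ such that $T_\omega(\mathfrak{A})=\mathfrak{A}$.
   Context: $\mathbb{F}_2^+$ is the free monoid on two generators $a,b$ (finite words in $a,b$), with empty word $e$; $|\omega|$ is the length of $\omega$. A tree is an element $\mathfrak{A}=(\mathfrak{A}_\omega)_{\omega\in\mathbb{F}_2^+}$ of $\{0,1\}^{\mathbb{F}_2^+}$ (a colored infinite binary tree; the root is the site $e$, and the left and right followers of the site $\omega$ are $\omega a$ and $\omega b$). The distance between two distinct trees $\mathfrak{A},\mathfrak{B}$ is $2^{-N}$ where $N$ is the minimal integer $n$ such that $\mathfrak{A}_\omega\ne\mathfrak{B}_\omega$ for some $|\omega|=n$; this makes the space of trees compact. For $\omega\in\mathbb{F}_2^+$, $T_\omega(\mathfrak{A})$ is the subtree of $\mathfrak{A}$ rooted at $\omega$: $(T_\omega(\mathfrak{A}))_\psi=\mathfrak{A}_{\omega\psi}$; thus $T_{\omega_0\ldots\omega_n}=T_{\omega_n}\circ\cdots\circ T_{\omega_0}$. The map $H$ (substreetution $0\mapsto$ root $0$ with followers $1,0$; $1\mapsto$ root $1$ with followers $1,0$; grammar BBAB) on trees is defined by: $H(\mathfrak{A})_e=\mathfrak{A}_e$, $H(\mathfrak{A})_a=1$, $H(\mathfrak{A})_b=0$, $T_{aa}(H(\mathfrak{A}))=H(T_b(\mathfrak{A}))$,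 $T_{ab}(H(\mathfrak{A}))=H(T_b(\mathfrak{A}))$, $T_{ba}(H(\mathfrak{A}))=H(T_a(\mathfrak{A}))$, $T_{bb}(H(\mathfrak{A}))=H(T_b(\mathfrak{A}))$. The Jacaranda tree $\mathfrak{J}$ is the unique tree with root $\mathfrak{J}_e=0$ and $H(\mathfrak{J})=\mathfrak{J}$. Strong aperiodicity: an $\mathbb{F}_2^+$-invariant set is weakly periodic if some element of it is fixed by $T_\omega$ for some $\omega$ with $|\omega|\ge1$; it is strongly aperiodic if it is not weakly periodic. *)

(* Defs.v *)
From HB Require Import structures.
From mathcomp Require Import all_boot all_order all_algebra.
From mathcomp Require Import boolp classical_sets reals topology.

Set Implicit Arguments.
Unset Strict Implicit.
Unset Printing Implicit Defensive.

Import Order.TTheory GRing.Theory Num.Theory.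

Local Open Scope classical_set_scope.
Local Open Scope ring_scope.

Inductive letter := La | Lb.

Definition word := seq letter.

(* The color 1 is [true] and the color 0 is [false]. The parameter [R] only
   fixes the field in which the distance between trees takes its values. *)
Definition tree (R : realType) : Type := word -> bool.

HB.instance Definition _ (R : realType) := gen_eqMixin (tree R).
HB.instance Definition _ (R : realType) := gen_choiceMixin (tree R).

Section Trees.
Context {R : realType}.
Implicit Types (A B C : tree R) (u v w : word) (X : set (tree R)) (n : nat).

Definition differ_at_level A B : pred nat :=
  fun n => `[< exists2 w, size w = n & A w <> B w >].

Lemma exists_differ A B : A <> B -> exists n, differ_at_level A B n.
Proof.
move=> AB; apply: contrapT => nAB; apply: AB; apply: funext => w.
apply: contrapT => ABw; apply: nAB; exists (size w).
by apply/asboolP; exists w.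
Qed.

Definition tree_dist A B : R :=
  match pselect (A = B) with
  | left _ => 0
  | right AB => 2 ^- ex_minn (exists_differ AB)
  end.

Lemma tree_distxx A : tree_dist A A = 0.
Proof. by rewrite /tree_dist; case: pselect. Qed.

Lemma tree_dist_ltP A B n :
  tree_dist A B < 2 ^- n <-> (forall w, (size w <= n)%N -> A w = B w).
Proof.
rewrite /tree_dist; case: pselect => [->|AB].
  by split=> // _; rewrite invr_gt0 exprn_gt0.
case: ex_minnP => m /asboolP[v vm ABv] m_min.
rewrite ltf_pV2 ?posrE ?exprn_gt0// ltr_eXn2l ?ltr1n//; split=> [nm w wn|nAB].
  apply: contrapT => ABw; have : (m <= size w)%N.
    by apply: m_min; apply/asboolP; exists w.
  by move=> mw; move: (leq_trans mw wn); rewrite leqNgt nm.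
by rewrite ltnNge; apply/negP => mn; apply: ABv; apply: nAB; rewrite vm.
Qed.

Lemma tree_dist_ge A B w : A w <> B w -> 2 ^- size w <= tree_dist A B.
Proof.
move=> ABw; rewrite leNgt; apply/negP => /tree_dist_ltP AB.
exact/ABw/AB.
Qed.

Lemma tree_dist_positivity A B : tree_dist A B = 0 -> A = B.
Proof.
rewrite /tree_dist; case: pselect => // AB /eqP.
by rewrite invr_eq0 expf_eq0 pnatr_eq0 andbF.
Qed.

Lemma tree_dist_sym A B : tree_dist A B = tree_dist B A.
Proof.
have le A' B' : tree_dist A' B' <= tree_dist B' A'.
  rewrite {1}/tree_dist; case: pselect => [->|AB]; first by rewrite tree_distxx.
  case: ex_minnP => m /asboolP[v <- ABv] _.
  by apply: tree_dist_ge => /esym.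
by apply/eqP; rewrite eq_le !le.
Qed.

Lemma tree_dist_triangle B A C :
  tree_dist A C <= tree_dist A B + tree_dist B C.
Proof.
have ge0 A' B' : 0 <= tree_dist A' B'.
  rewrite /tree_dist; case: pselect => // AB.
  by rewrite invr_ge0 exprn_ge0.
rewrite {1}/tree_dist; case: pselect => [_|AC]; first by rewrite addr_ge0.
case: ex_minnP => m /asboolP[v <- ACv] _.
have [ABv|/eqP ABv] := eqVneq (A v) (B v).
  rewrite -[leLHS]add0r lerD//; apply: tree_dist_ge => BCv.
  by apply: ACv; rewrite ABv.
by rewrite -[leLHS]addr0 lerD// tree_dist_ge.
Qed.

End Trees.

HB.instance Definition _ (R : realType) := @isMetric.Build R (tree R)
  (@tree_dist R) (@tree_distxx R) (@tree_dist_positivity R) (@tree_dist_sym R)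
  (@tree_dist_triangle R).

Section Dynamics.
Context {R : realType}.
Implicit Types (A B J : tree R) (u v w : word) (X : set (tree R)) (n : nat).

Definition subtree w A : tree R := fun v => A (w ++ v).

Lemma subtree_cat u v A : subtree (u ++ v) A = subtree v (subtree u A).
Proof. by apply: funext => w; rewrite /subtree catA. Qed.

Definition orbit A : set (tree R) := [set subtree w A | w in [set: word]].

Definition orbit_closure A : set (tree R) := closure (orbit A).

Definition invariant X := forall A w, X A -> X (subtree w A).

(* The next two notions are meant for invariant sets; orbit closures are
   invariant by [orbit_closure_invariant]. *)
Definition weakly_periodic X :=
  exists A w, [/\ X A, (1 <= size w)%N & subtree w A = A].

Definition strongly_aperiodic X := ~ weakly_periodic X.

Lemma closure_treeP X A :
  closure X A <->
  (forall n, exists2 B, X B & forall w, (size w <= n)%N -> A w = B w).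
Proof.
split=> [clA n|XA V].
  have [|B [XB]] := clA (ball A (2 ^- n : R)).
    by apply: nbhsx_ballx; rewrite invr_gt0 exprn_gt0.
  by rewrite ballEmdist => /tree_dist_ltP AB; exists B.
rewrite -nbhs_ballE => -[e /= e0 AV].
have [n ne] : exists n, (2 ^- n : R) < e.
  exists (Num.bound e^-1).
  by rewrite -[e]invrK ltf_pV2 ?posrE ?invr_gt0 ?exprn_gt0// invrK upper_nthrootP.
have [B XB AB] := XA n; exists B; split=> //; apply: AV.
rewrite ballEmdist /=; apply: lt_trans ne; exact/tree_dist_ltP.
Qed.

Lemma orbit_closure_invariant A : invariant (orbit_closure A).
Proof.
move=> B w /closure_treeP clB; apply/closure_treeP => n.
have [_ [v _ <-] BC] := clB (size w + n)%N.
exists (subtree w (subtree v A)).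
  by exists (v ++ w) => //; rewrite subtree_cat.
by move=> u un; apply: BC; rewrite size_cat leq_add2l.
Qed.

Fixpoint H A w {struct w} : bool :=
  match w with
  | [::] => A [::]
  | [:: La] => true
  | [:: Lb] => false
  | La :: La :: v => H (subtree [:: Lb] A) v
  | La :: Lb :: v => H (subtree [:: Lb] A) v
  | Lb :: La :: v => H (subtree [:: La] A) v
  | Lb :: Lb :: v => H (subtree [:: Lb] A) v
  end.

Definition is_jacaranda J := J [::] = false /\ H J = J.

Lemma H_agree n A B : (forall w, (size w <= n)%N -> A w = B w) ->
  forall w, (size w <= n.+1)%N -> H A w = H B w.
Proof.
elim/ltn_ind: n A B => n IH A B AB [|x [|y v]] /=; first by rewrite AB.
  by case: x.
rewrite ltnS => vn.
case: n => [//|n] in IH AB vn *.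
have ABs c w : (size w <= n)%N -> subtree [:: c] A w = subtree [:: c] B w.
  by move=> wn; apply: AB.
have Hs c : H (subtree [:: c] A) v = H (subtree [:: c] B) v.
  by apply: (IH n) => // [w|]; [exact: ABs|rewrite ltnW].
by case: x; case: y.
Qed.

Lemma jacaranda_unique J J' : is_jacaranda J -> is_jacaranda J' -> J = J'.
Proof.
move=> [J0 HJ] [J'0 HJ'].
suff JJ n w : (size w <= n)%N -> J w = J' w by apply: funext => w; exact: JJ.
elim: n w => [|n IH] w; first by rewrite leqn0 => /nilP ->; rewrite J0.
by rewrite -HJ -HJ'; exact: H_agree.
Qed.

Lemma jacaranda_exists : exists J, is_jacaranda J.
Proof.
pose K n : tree R := iter n H (fun=> false).
have KS n w : (size w <= n)%N -> K n w = K n.+1 w.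
  elim: n w => [|n IH] w; first by rewrite leqn0 => /nilP ->.
  exact: H_agree.
have Kle n m w : (size w <= n <= m)%N -> K n w = K m w.
  move=> /andP[wn]; elim: m => [|m IH]; first by rewrite leqn0 => /eqP ->.
  rewrite leq_eqVlt => /predU1P[->//|nm].
  by rewrite IH// KS// (leq_trans wn).
exists (fun w => K (size w) w); split=> //; apply: funext => w.
transitivity (K (size w).+1 w); last by rewrite -KS.
rewrite [RHS]/= -/(K (size w)); apply: (@H_agree (size w)) => // v vw.
by apply: Kle; rewrite leqnn.
Qed.

End Dynamics.

Definition jacaranda (R : realType) : tree R :=
  sval (cid (@jacaranda_exists R)).

Lemma jacarandaP (R : realType) : is_jacaranda (jacaranda R).
Proof. exact: svalP (cid (@jacaranda_exists R)). Qed.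

(* Main.v *)
Require Import Defs.
From mathcomp Require Import all_boot all_order all_algebra.
From mathcomp Require Import boolp classical_sets reals topology.

(** The proof is a descent on the length of the period. Write [J] for the
    Jacaranda tree. Reading a word of even length by blocks of two letters
    through aa, ab, bb |-> b and ba |-> a ([block_code]), the equation [H J = J]
    says that [J] at a word of even length is [J] at the encoded word
    ([jacaranda_even]), and that [J] at a word of odd length only depends on its
    last letter ([jacaranda_odd]).

    Consequently the parity of [size u] can be read off the subtree of [J] rooted
    at [u]: its colors at aa and ab agree exactly when [size u] is even
    ([jacaranda_parity]). This passes to limits, so that every tree of the
    orbit closure is either even or odd, and descending along a word of odd
    length exchanges the two classes. A period [w] therefore has even length.

    Now let [subtree w A = A] with [A] in the orbit closure. If [A] is odd, move
    one letter down along [w]; this rotates the period [w], keeps its length,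
    and makes [A] even. If [A] is even, then it is [H B] for the tree [B] that
    samples [A] along [block_decode], a right inverse of [block_code]. This [B]
    is again in the orbit closure ([block_decode_closure]), and has the period
    [block_code w] ([block_decode_periodic]), half as long as [w]. *)

Set Implicit Arguments.
Unset Strict Implicit.
Unset Printing Implicit Defensive.

(** ba |-> a and aa, ab, bb |-> b on successive blocks of two letters; a last
    unpaired letter is dropped. *)
Fixpoint block_code (w : word) : word :=
  match w with
  | Lb :: La :: v => La :: block_code v
  | _ :: _ :: v => Lb :: block_code v
  | _ => [::]
  end.

(** The right inverse a |-> ba, b |-> bb of [block_code]. *)
Fixpoint block_decode (w : word) : word :=
  if w is c :: v then [:: Lb, c & block_decode v] else [::].

Definition is_a (c : letter) : bool := if c is La then true else false.

Lemma word_pair_ind (P : word -> Prop) :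
  P [::] -> (forall c, P [:: c]) -> (forall c d v, P v -> P [:: c, d & v]) ->
  forall w, P w.
Proof.
move=> P0 P1 P2 w; suff [] : P w /\ forall c, P (c :: w) by [].
by elim: w => [|c w [IH1 IH2]]; split=> // d; exact: P2.
Qed.

Lemma size_block_code w : size (block_code w) = (size w)./2.
Proof. by elim/word_pair_ind: w => // [[]|[] [] v /= ->]. Qed.

Lemma block_code_cat u v : ~~ odd (size u) ->
  block_code (u ++ v) = block_code u ++ block_code v.
Proof.
elim/word_pair_ind: u => // c d u IH /=.
by rewrite negbK => /IH; case: c; case: d => /= ->.
Qed.

Lemma size_block_decode w : size (block_decode w) = (size w).*2.
Proof. by elim: w => //= c w ->. Qed.

Lemma block_decodeK w : block_code (block_decode w) = w.
Proof. by elim: w => // [[] w /= ->]. Qed.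

Lemma block_decode_cat u v :
  block_decode (u ++ v) = block_decode u ++ block_decode v.
Proof. by elim: u => //= c u ->. Qed.

Lemma H_even (R : realType) (A : tree R) w : ~~ odd (size w) ->
  H A w = A (block_code w).
Proof.
elim/word_pair_ind: w A => // c d v IH A /=.
by rewrite negbK => vev; case: c; case: d; rewrite IH.
Qed.

Lemma H_odd (R : realType) (A : tree R) w c : ~~ odd (size w) ->
  H A (rcons w c) = is_a c.
Proof.
elim/word_pair_ind: w A => [A _| |x y v IH A] //=.
by rewrite negbK => vev; case: x; case: y; rewrite IH.
Qed.

Lemma jacaranda_even (R : realType) w : ~~ odd (size w) ->
  jacaranda R w = jacaranda R (block_code w).
Proof. by move=> ?; rewrite -{1}(jacarandaP R).2 H_even. Qed.

Lemma jacaranda_odd (R : realType) w c : ~~ odd (size w) ->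
  jacaranda R (rcons w c) = is_a c.
Proof. by move=> ?; rewrite -(jacarandaP R).2 H_odd. Qed.

Lemma jacaranda_parity (R : realType) u :
  (jacaranda R (u ++ [:: La; La]) == jacaranda R (u ++ [:: La; Lb])) =
  ~~ odd (size u).
Proof.
have [uodd|uev] := boolP (odd (size u)).
  by rewrite -!(cat_rcons La u) !cats1 !jacaranda_odd// size_rcons /= uodd.
(* The blocks aa and ab have the same code. *)
have blk c : jacaranda R (u ++ [:: La; c]) =
             jacaranda R (block_code u ++ [:: Lb]).
  by rewrite jacaranda_even ?block_code_cat// size_cat addn2 /= negbK.
by rewrite !blk eqxx.
Qed.

Lemma orbit_closureP (R : realType) (J A : tree R) :
  orbit_closure J A <->
  forall n, exists u, forall v, (size v <= n)%N -> A v = J (u ++ v).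
Proof.
rewrite /orbit_closure closure_treeP; split=> XA n.
  by have [_ [u _ <-] Au] := XA n; exists u.
by have [u Au] := XA n; exists (subtree u J) => //; exists u.
Qed.

(** The parity of a tree. For [A] in the orbit closure, [even_tree A] means that
    [A] is a limit of subtrees of the Jacaranda tree rooted at words of even
    length, see [even_tree_root]; for an arbitrary tree it carries no meaning. *)
Definition even_tree (R : realType) (A : tree R) : bool :=
  A [:: La; La] == A [:: La; Lb].

Lemma even_tree_root (R : realType) (A : tree R) u n : (1 < n)%N ->
  (forall v, (size v <= n)%N -> A v = jacaranda R (u ++ v)) ->
  even_tree A = ~~ odd (size u).
Proof. by move=> n1 Au; rewrite /even_tree !Au// jacaranda_parity. Qed.

Lemma even_tree_subtree (R : realType) (A : tree R) w :
  orbit_closure (jacaranda R) A ->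
  even_tree (subtree w A) = even_tree A (+) odd (size w).
Proof.
move=> /orbit_closureP /(_ (size w + 2)%N)[u Au].
rewrite (even_tree_root _ Au) ?addn2//.
rewrite (@even_tree_root _ _ (u ++ w) 2)// => [|v v2].
  by rewrite size_cat oddD addNb.
by rewrite -catA -Au// size_cat leq_add2l.
Qed.

Lemma period_even (R : realType) (A : tree R) w :
  orbit_closure (jacaranda R) A -> subtree w A = A -> ~~ odd (size w).
Proof.
move=> XA wA; move: (even_tree_subtree w XA); rewrite wA.
by case: even_tree; case: odd.
Qed.

(** The desubstitution of an even tree of the orbit closure is in the orbit
    closure: if [A] agrees with [subtree u J] near the root and [size u] is even,
    then the desubstituted tree agrees with [subtree (block_code u) J]. *)
Lemma block_decode_closure (R : realType) (A : tree R) :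
  orbit_closure (jacaranda R) A -> even_tree A ->
  orbit_closure (jacaranda R) (A \o block_decode : tree R).
Proof.
move=> /orbit_closureP XA Aev; apply/orbit_closureP => n.
have [u Au] := XA (n.*2 + 2)%N.
have uev : ~~ odd (size u) by rewrite -(even_tree_root _ Au)// addn2.
exists (block_code u) => v vn /=.
rewrite Au ?size_block_decode ?(leq_trans _ (leq_addr _ _)) ?leq_double//.
rewrite jacaranda_even ?block_code_cat ?block_decodeK//.
by rewrite size_cat size_block_decode oddD odd_double addbF.
Qed.

Lemma block_decode_periodic (R : realType) (A : tree R) w :
  orbit_closure (jacaranda R) A -> even_tree A -> subtree w A = A ->
  subtree (block_code w) (A \o block_decode : tree R) = A \o block_decode.
Proof.
move=> XA Aev wA; have wev := period_even XA wA.
apply: funext => v; rewrite /subtree /= -[in RHS]wA /subtree block_decode_cat.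
move/orbit_closureP: XA => /(_ (size w + (size v).*2 + 2)%N)[u Au].
have uev : ~~ odd (size u) by rewrite -(even_tree_root _ Au)// addn2.
(* The colors of [A] below [w] and below [block_decode (block_code w)] coincide
   at the words of the image of [block_decode]: both words have the same length
   and the same code. *)
have sz x : size x = size w ->
    A (x ++ block_decode v) = jacaranda R (block_code u ++ block_code x ++ v).
  move=> xw; rewrite Au ?size_cat ?xw ?size_block_decode ?leq_addr//.
  rewrite jacaranda_even ?block_code_cat ?xw ?block_decodeK//.
  by rewrite !size_cat xw size_block_decode !oddD odd_double addbF (negPf wev)
    addbF.
by rewrite !sz ?block_decodeK// size_block_decode size_block_code even_halfK.
Qed.

Theorem theorem1 (R : realType) :
  strongly_aperiodic (orbit_closure (jacaranda R)).
Proof.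
move=> [A [w [XA w0 wA]]].
have [n] := ubnP (size w); elim: n A w XA w0 wA => // n IH A w XA w0 wA.
rewrite ltnS => wn.
(* An even tree with a period as long as [w] has a desubstitution with a period
   half as long, which the induction hypothesis excludes. *)
have descent B v : orbit_closure (jacaranda R) B -> subtree v B = B ->
    size v = size w -> ~~ even_tree B.
  move=> XB vB vw; apply/negP => Bev.
  have := period_even XB vB; rewrite vw => wev.
  have w1 : (1 < size w)%N by case: (size w) w0 wev => [|[]].
  apply: (IH _ _ (block_decode_closure XB Bev) _
             (block_decode_periodic XB Bev vB)).
    by rewrite size_block_code vw half_gt0.
  rewrite size_block_code vw; apply: leq_trans wn.
  by rewrite ltn_half_double -addnn -{1}[size w]addn0 ltn_add2l.
case: w w0 wA {wn IH} descent => // c w _ wA descent.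
have Aodd := descent _ _ XA wA erefl.
have XcA : orbit_closure (jacaranda R) (subtree [:: c] A).
  exact: orbit_closure_invariant.
(* The period of the subtree one letter down is [w] with [c] moved to the end. *)
have cA : subtree (rcons w c) (subtree [:: c] A) = subtree [:: c] A.
  by rewrite -subtree_cat -cats1 -[_ ++ (_ ++ _)]/((c :: w) ++ [:: c])
    subtree_cat wA.
have /negP := descent _ _ XcA cA (size_rcons _ _); apply.
by rewrite even_tree_subtree// (negPf Aodd).
Qed.
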